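(* Let $0<a\le 1$ and let $\rho$ be any slope in the interior $\stackrel{\circ}{\mathcal P}$ of $\mathcal P$. Then for every local function $g$ on $\Omega_{\mathbb Z^2}$, $$\mathbb E_{\pi_\rho}\big[g(T(\eta))\big]=\pi_\rho(g(\eta)),$$ where $\eta\sim\pi_\rho$ and the expectation on the left is both over $\eta$ and over the independent randomness of the map $T$. That is, $\pi_\rho$ is stationary for the Markov chain on $\Omega_{\mathbb Z^2}$ defined by $T$.
   Context: Lattice. Vertices of $\mathbb Z^2$ are alternately coloured black and white. Faces are labelled $(i,j)\in\mathbb Z^2$; $(i+1,j)$ is the face to the right of $(i,j)$ and $(i,j+1)$ the face above it. A face is even if its top-right vertex is white (equivalently $i+j$ even), odd otherwise. $\Omega_{\mathbb Z^2}$ is the set of perfect matchings (dimer coverings) of $\mathbb Z^2$. For $L\ge1$, $\mathbb T_L$ is $\mathbb Z^2$ periodized with period $2L$ horizontally and vertically (same colouring and face conventions, indices mod $2L$), and $\Omega_L$ is its set of perfect matchings. A local function depends only on the matching restricted to a finite set of edges. Two-periodic weights. The even face $(i,j)$ is labelled ''$a$'' if $i,j$ are both even and ''$1$'' if $i,j$ are both odd. Each edge belongs to exactly one even face and its weight is the label ($a$ or $1$) of that face. Slopes and Gibbs measures. Let $C_1$ (resp. $C_2$) be a horizontal (resp. vertical) nearest-neighbour closed path of length $2L$ on faces of $\mathbb T_L$, directed right (resp. up). For $\eta\in\Omega_L$, $\Delta_i(\eta)=\sum_{e\in C_i}\sigma_e 1_{e\in\eta}$, the sum being over edges crossed by $C_i$,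 with $\sigma_e=+1$ if $e$ is crossed with its white vertex on the right and $\sigma_e=-1$ otherwise. $\Omega_L(\Delta)=\{\eta\in\Omega_L:\Delta_i(\eta)=\Delta_i,\ i=1,2\}$. $\mathcal P$ is the closed square with vertices $(\pm1,0),(0,\pm1)$. For $\Delta/L\in\stackrel{\circ}{\mathcal P}$, $\pi^{(L)}_\Delta$ is the probability measure on $\Omega_L(\Delta)$ with weights proportional to $a^{N_a(\eta)}$, $N_a(\eta)$ being the number of dimers on edges of weight $a$. If $\Delta^{(L)}/L\to\rho\in\stackrel{\circ}{\mathcal P}$, the measures $\pi^{(L)}_{\Delta^{(L)}}$ converge, on bounded local functions, to a limit $\pi_\rho$, a probability measure on $\Omega_{\mathbb Z^2}$ (known result of Kenyon–Okounkov–Sheffield). Dynamics. The random map $F_0:\Omega_{\mathbb Z^2}\to\Omega_{\mathbb Z^2}$ acts on $\eta$ as follows: (deletion) for each even face with two parallel dimers of $\eta$ on its boundary, remove both; (sliding) for each even face with exactly one boundary edge covered by a dimer of $\eta$, move that dimer to the opposite edge of the face; (creation) for each even face with no dimer of $\eta$ on its boundary, add two parallel vertical dimers with probability $1/2$ or two parallel horizontal dimers with probability $1/2$, independently over faces. The random map $F_1$ is defined in the same way with ''even'' replaced by ''odd'', except that the creation probabilities are: for an odd face $(i,j)$ with $(i,j)\bmod 2=(1,0)$, vertical pair with probability $1/(1+a^2)$ and horizontal pair with probability $a^2/(1+a^2)$; for $(i,j)\bmod2=(0,1)$, vertical pair with probability $a^2/(1+a^2)$ and horizontal pair with probability $1/(1+a^2)$.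 All random choices are independent. $\tau_n$ denotes translation of configurations by $n\in\mathbb Z^2$, and $T(\eta):=\tau_{(-1,-1)}[F_1\circ F_0(\eta)]$. *)

(* Defs.v *)
From HB Require Import structures.
From mathcomp Require Import all_boot all_order all_algebra.
From mathcomp Require Import finmap zify.
From mathcomp Require Import all_classical all_reals all_analysis.

Set Implicit Arguments.
Unset Strict Implicit.
Unset Printing Implicit Defensive.

Import Order.TTheory GRing.Theory Num.Theory.
Import numFieldNormedType.Exports.

Local Open Scope classical_set_scope.
Local Open Scope ring_scope.

(* The index ring G is int for the square lattice and 'Z_(2 * L) for the      *)
(* torus.  An edge is named by its orientation and its left (resp. lower)     *)
(* end, so that the double edges of the torus with L = 1 remain distinct.     *)
Definition vertex (G : Type) : Type := (G * G)%type.
Definition edge (G : Type) : Type := (bool * (G * G))%type.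

Definition hedge (G : Type) (x y : G) : edge G := (false, (x, y)).
Definition vedge (G : Type) (x y : G) : edge G := (true, (x, y)).
Definition vertical (G : Type) (e : edge G) : bool := e.1.

Definition incident (G : comPzRingType) (v : vertex G) : seq (edge G) :=
  [:: hedge v.1 v.2; hedge (v.1 - 1) v.2; vedge v.1 v.2; vedge v.1 (v.2 - 1)].

Definition perfect_matching (G : comPzRingType) (m : edge G -> bool) : Prop :=
  forall v : vertex G, count m (incident v) = 1%N.

(* Face (i, j) is the unit square with lower left corner (i, j). *)
Definition oddz (n : int) : bool := ~~ (2 %| n)%Z.
Definition white (v : vertex int) : bool := ~~ oddz (v.1 + v.2).

Definition face : Type := (int * int)%type.
Definition even_face (f : face) : bool := white (f.1 + 1, f.2 + 1).

Definition bottom_edge (f : face) : edge int := hedge f.1 f.2.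
Definition top_edge (f : face) : edge int := hedge f.1 (f.2 + 1).
Definition left_edge (f : face) : edge int := vedge f.1 f.2.
Definition right_edge (f : face) : edge int := vedge (f.1 + 1) f.2.
Definition boundary (f : face) : seq (edge int) :=
  [:: bottom_edge f; top_edge f; left_edge f; right_edge f].

(* The even (ev = true) or odd (ev = false) face with e on its boundary. *)
Definition face_of (ev : bool) (e : edge int) : face :=
  if even_face e.2 == ev then e.2
  else if vertical e then (e.2.1 - 1, e.2.2) else (e.2.1, e.2.2 - 1).

Definition opposite (f : face) (e : edge int) : edge int :=
  if e == bottom_edge f then top_edge f
  else if e == top_edge f then bottom_edge f
  else if e == left_edge f then right_edge f
  else left_edge f.

Lemma face_ofP ev e f :
  (even_face f == ev) && (e \in boundary f) = (f == face_of ev e).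
Proof.
case: e f => [[] [x y]] [i j]; rewrite /face_of /boundary !inE /vertical /=;
  rewrite /bottom_edge /top_edge /left_edge /right_edge /hedge /vedge;
  rewrite !xpair_eqE /= /even_face /white /oddz /=; case: ev; case: ifP; rewrite !xpair_eqE; lia.
Qed.

Definition matchings : set (edge int -> bool) :=
  [set m | perfect_matching m].

Definition brick (e : edge int) : bool := ~~ vertical e && ~~ oddz e.2.1.

Lemma brick_matching : perfect_matching brick.
Proof.
move=> [x y]; rewrite /brick /vertical /oddz /=; lia.
Qed.

HB.instance Definition _ :=
  isPointed.Build matchings (SigSub (mem_set brick_matching)).

Definition edge_events : set (set matchings) :=
  range (fun e : edge int => [set eta : matchings | val eta e]).

Definition Omega : Type := g_sigma_algebraType edge_events.

(* tau_n moves every dimer by n. *)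
Definition shift (n : int * int) (m : edge int -> bool) : edge int -> bool :=
  fun e => m (e.1, (e.2.1 - n.1, e.2.2 - n.2)).

Lemma shift_matching n m : perfect_matching m -> perfect_matching (shift n m).
Proof.
move=> mP [x y]; rewrite -(mP (x - n.1, y - n.2)) /shift /=.
by rewrite !(addrAC _ (- 1)).
Qed.

Definition tau (n : int * int) (eta : Omega) : Omega :=
  SigSub (mem_set (shift_matching n (set_valP eta))).

(* On each face of parity ev: creation if it carries no dimer (a vertical     *)
(* pair when coin is true), sliding if it carries one, deletion if it carries *)
(* two, which are then parallel since m is a matching.                        *)
Definition update (ev : bool) (coin : face -> bool) (m : edge int -> bool)
    (e : edge int) : bool :=
  let f := face_of ev e in
  match count m (boundary f) with
  | 0%N => coin f == vertical e
  | 1%N => m (opposite f e)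
  | _ => false
  end.

Lemma updateE ev coin m f : even_face f == ev ->
  let new (c : bool) (e : edge int) :=
    match count m (boundary f) with 0%N => c | 1%N => m e | _ => false end in
  [/\ update ev coin m (bottom_edge f) = new (~~ coin f) (top_edge f),
      update ev coin m (top_edge f) = new (~~ coin f) (bottom_edge f),
      update ev coin m (left_edge f) = new (coin f) (right_edge f) &
      update ev coin m (right_edge f) = new (coin f) (left_edge f)].
Proof.
move=> fev new.
have E e : e \in boundary f -> face_of ev e = f.
  by move=> ef; apply/esym/eqP; rewrite -face_ofP fev.
have D (x : int) : (x + 1 == x) = false by lia.
rewrite /update !E ?inE ?eqxx ?orbT // {}/new.
case: f {fev E} => x y; rewrite /opposite /top_edge /bottom_edge /left_edge.
rewrite /right_edge /hedge /vedge /vertical !xpair_eqE /= !eqxx !D /= /boundary.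
by case: (coin _); split.
Qed.

Lemma update_matching ev coin m :
  perfect_matching m -> perfect_matching (update ev coin m).
Proof.
move=> mP [x y].
have K (z : int) : z - 1 + 1 = z by rewrite subrK.
have K' (z : int) : z + 1 - 1 = z by rewrite addrK.
have U (p q s t : bool) :
    (p + (q + (s + (t + 0))))%N = 1%N -> [/\ ~~ (q && t), ~~ (q && s),
      ~~ (p && t), ~~ (p && s) & (p + q + s + t)%N = 1%N].
  by case: p q s t => [] [] [] [].
have [fev|fev] := boolP (even_face (x, y) == ev).
- have fev' : even_face (x - 1, y - 1) == ev.
    by move: fev; rewrite /even_face /white /oddz /=; case: (ev); lia.
  have [u1 _ u3 _] := updateE coin m fev.
  have [_ u2 _ u4] := updateE coin m fev'.
  move: u1 u2 u3 u4.
  rewrite /top_edge /bottom_edge /left_edge /right_edge /= !K => u1 u2 u3 u4.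
  have /U[_ _ _ _ V] := mP (x, y).
  have /U[V1 _ _ _ _] := mP (x + 1, y + 1).
  have /U[_ _ _ V2 _] := mP (x - 1, y - 1).
  rewrite /= u1 u2 u3 u4 /boundary /top_edge /bottom_edge /left_edge.
  rewrite /right_edge /= !K.
  rewrite /= ?K ?K' in V1 V2 V *.
  move: (coin (x, y)) (coin (x - 1, y - 1)) (m (hedge x y))
    (m (hedge (x - 1) y)) (m (vedge x y)) (m (vedge x (y - 1)))
    (m (hedge x (y + 1))) (m (vedge (x + 1) y)) (m (hedge (x - 1) (y - 1)))
    (m (vedge (x - 1) (y - 1))) V V1 V2.
  by do 10![case].
- have fev1 : even_face (x - 1, y) == ev.
    by move: fev; rewrite /even_face /white /oddz /=; case: (ev); lia.
  have fev2 : even_face (x, y - 1) == ev.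
    by move: fev; rewrite /even_face /white /oddz /=; case: (ev); lia.
  have [u1 _ _ u2] := updateE coin m fev1.
  have [_ u3 u4 _] := updateE coin m fev2.
  move: u1 u2 u3 u4.
  rewrite /top_edge /bottom_edge /left_edge /right_edge /= !K => u1 u2 u3 u4.
  have /U[_ _ _ _ V] := mP (x, y).
  have /U[_ _ V1 _ _] := mP (x - 1, y + 1).
  have /U[_ V2 _ _ _] := mP (x + 1, y - 1).
  rewrite /= u1 u2 u3 u4 /boundary /top_edge /bottom_edge /left_edge.
  rewrite /right_edge /= !K.
  rewrite /= ?K ?K' in V1 V2 V *.
  move: (coin (x - 1, y)) (coin (x, y - 1)) (m (hedge x y))
    (m (hedge (x - 1) y)) (m (vedge x y)) (m (vedge x (y - 1)))
    (m (hedge (x - 1) (y + 1))) (m (vedge (x - 1) y)) (m (hedge x (y - 1)))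
    (m (vedge (x + 1) (y - 1))) V V1 V2.
  by do 10![case].
Qed.

Definition face_update (ev : bool) (coin : face -> bool) (eta : Omega) : Omega :=
  SigSub (mem_set (update_matching ev coin (set_valP eta))).

(* F_0 reads coin on even faces only and F_1 on odd faces only. *)
Definition F0 (coin : face -> bool) : Omega -> Omega := face_update true coin.
Definition F1 (coin : face -> bool) : Omega -> Omega := face_update false coin.
Definition Tmap (coin : face -> bool) (eta : Omega) : Omega :=
  tau (-1, -1) (F1 coin (F0 coin eta)).

Definition vertical_prob (R : realType) (a : R) (f : face) : R :=
  if even_face f then 2^-1
  else if oddz f.1 then (1 + a ^+ 2)^-1 else a ^+ 2 / (1 + a ^+ 2).

(* Mutual independence of a family of random variables with values in         *)
(* possibly different spaces, through the events F i determined by the i-th.  *)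
Definition mutually_independent d (W : measurableType d) (R : realType)
    (P : probability W R) (I : choiceType) (F : I -> set (set W)) : Prop :=
  forall (J : {fset I}) (E : I -> set W), (forall i, i \in J -> F i (E i)) ->
  P (\bigcap_(i in [set` J]) E i) = (\prod_(i <- J) P (E i))%E.

Definition events_of d d' (W : measurableType d) (S : measurableType d')
    (X : W -> S) : set (set W) := preimage_set_system setT X measurable.

(* eta and all the coins form one independent family, indexed by option face. *)
Definition config_and_coins (R : realType) (a : R) (pi : probability Omega R)
    d (W : measurableType d) (P : probability W R)
    (eta : {RV P >-> Omega}) (coin : face -> {RV P >-> bool}) : Prop :=
  [/\ forall A, measurable A -> distribution P eta A = pi A,
      forall f, P [set w | coin f w] = (vertical_prob a f)%:E &
      mutually_independent P (fun i : option face =>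
        if i is Some f then events_of (coin f) else events_of eta)].

(* A torus edge is represented in the plane with coordinates in [0, 2L); the  *)
(* colouring and the weights have even period, so that any other              *)
(* representative gives the same value.                                       *)
Definition plane_edge L (e : edge 'Z_(2 * L)) : edge int :=
  (e.1, ((e.2.1 : nat)%:Z, (e.2.2 : nat)%:Z)).
Definition torus_edge L (e : edge int) : edge 'Z_(2 * L) :=
  (e.1, (e.2.1%:~R, e.2.2%:~R)).

Definition torus_matching L (m : {ffun edge 'Z_(2 * L) -> bool}) : bool :=
  [forall v : vertex 'Z_(2 * L), count m (incident v) == 1%N].

(* For L = 0 the index ring 'Z_0 is junk; only L >= 1 is meaningful. *)
Definition Omega_torus L : Type :=
  {m : {ffun edge 'Z_(2 * L) -> bool} | torus_matching m}.

Lemma lift_matching L (eta : Omega_torus L) :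
  perfect_matching (val eta \o @torus_edge L).
Proof.
move=> [x y]; have /forallP/(_ (x%:~R, y%:~R))/eqP E := valP eta.
by apply: etrans E; rewrite /torus_edge /= !rmorphB /=.
Qed.

(* The periodic matching of the plane; local functions are evaluated on the   *)
(* torus through it.                                                          *)
Definition periodic_lift L (eta : Omega_torus L) : Omega :=
  SigSub (mem_set (lift_matching eta)).

(* The path through the faces (., j), directed right, crosses vedge x j with  *)
(* its lower end on the right; the path through the faces (i, .), directed    *)
(* up, crosses hedge i y with its right end on the right.                     *)
Definition sign (b : bool) : int := if b then 1 else -1.
Definition flux1 L (j : 'Z_(2 * L)) (eta : Omega_torus L) : int :=
  \sum_(x : 'Z_(2 * L) | val eta (vedge x j))
    sign (white (plane_edge (vedge x j)).2).
Definition flux2 L (i : 'Z_(2 * L)) (eta : Omega_torus L) : int :=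
  \sum_(y : 'Z_(2 * L) | val eta (hedge i y))
    sign (white (((i : nat) + 1)%:Z, (y : nat)%:Z)).

Section FluxConstant.
Context (L : nat) (L0 : (0 < L)%N) (eta : Omega_torus L).
Let N := (2 * L)%N.

Let s (x y : 'Z_N) : int := sign (~~ odd (x + y)).

Let oddN : odd (Zp_trunc N).+2 = false.
Proof. by rewrite Zp_cast ?oddM // /N; move: L0; lia. Qed.

Let oddS (x : 'Z_N) : odd (x + 1)%R = ~~ odd x.
Proof. by rewrite /= odd_mod // oddD odd_mod // addbT. Qed.

Let sSl x y : s (x + 1) y = - s x y.
Proof. by rewrite /s !oddD oddS; case: (odd x); case: (odd y). Qed.

Let sSr x y : s x (y + 1) = - s x y.
Proof. by rewrite /s !oddD oddS; case: (odd x); case: (odd y). Qed.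

Let sum_shift_l (y : 'Z_N) (F : 'Z_N -> int) :
  \sum_x s x y * F (x - 1) = - \sum_x s x y * F x.
Proof.
rewrite (reindex_inj (addIr 1)) -sumrN; apply: eq_bigr => x _.
by rewrite sSl addrK mulNr.
Qed.

Let sum_shift_r (x : 'Z_N) (F : 'Z_N -> int) :
  \sum_y s x y * F (y - 1) = - \sum_y s x y * F y.
Proof.
rewrite (reindex_inj (addIr 1)) -sumrN; apply: eq_bigr => y _.
by rewrite sSr addrK mulNr.
Qed.

Let flux1E j : flux1 j eta = \sum_x s x j * (val eta (vedge x j) : nat)%:Z.
Proof.
rewrite /flux1 big_mkcond; apply: eq_bigr => x _.
rewrite /s /white /oddz /plane_edge /=.
by case: (val eta _); rewrite ?mulr0 // mulr1; congr sign; lia.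
Qed.

Let flux2E i : flux2 i eta = - \sum_y s i y * (val eta (hedge i y) : nat)%:Z.
Proof.
rewrite /flux2 big_mkcond -sumrN; apply: eq_bigr => y _.
rewrite /s /white /oddz /=.
case: (val eta _); rewrite ?mulr0 ?oppr0 // mulr1.
suff -> : ~~ ~~ (2 %| (i + 1)%N%:Z + (y : nat)%:Z)%Z = odd (i + y).
  by case: (odd _).
lia.
Qed.

Let vertexE x y : (val eta (hedge x y) : nat)%:Z +
  (val eta (hedge (x - 1) y) : nat)%:Z + (val eta (vedge x y) : nat)%:Z +
  (val eta (vedge x (y - 1)) : nat)%:Z = 1.
Proof.
have /forallP/(_ (x, y))/eqP /= := valP eta.
by rewrite addn0 !addnA -!PoszD => ->.
Qed.

Let zero_l y (c : int) : \sum_x s x y * c = 0.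
Proof. by have := sum_shift_l y (fun=> c) => /=; lia. Qed.

Let zero_r x (c : int) : \sum_y s x y * c = 0.
Proof. by have := sum_shift_r x (fun=> c) => /=; lia. Qed.

Lemma flux1_const j : flux1 j eta = flux1 0 eta.
Proof.
have step k : flux1 k eta = flux1 (k - 1) eta.
  rewrite !flux1E; pose h x := (val eta (hedge x k) : nat)%:Z.
  have : \sum_x (s x k * h x + s x k * h (x - 1) +
      s x k * (val eta (vedge x k) : nat)%:Z +
      s x k * (val eta (vedge x (k - 1)) : nat)%:Z) = 0.
    by rewrite -[RHS](zero_l k 1); apply: eq_bigr => x _; rewrite -!mulrDr vertexE.
  rewrite !big_split /= sum_shift_l.
  have -> : \sum_x s x k * (val eta (vedge x (k - 1)) : nat)%:Z =
    - \sum_x s x (k - 1) * (val eta (vedge x (k - 1)) : nat)%:Z.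
    by rewrite -sumrN; apply: eq_bigr => x _; rewrite -mulNr -sSr subrK.
  by rewrite subrr add0r => /eqP; rewrite subr_eq0 => /eqP.
rewrite -[j]natr_Zp; elim: (j : nat) => [//|k IH].
by rewrite step -natr1 addrK.
Qed.

Lemma flux2_const i : flux2 i eta = flux2 0 eta.
Proof.
have step k : flux2 k eta = flux2 (k - 1) eta.
  rewrite !flux2E; pose v y := (val eta (vedge k y) : nat)%:Z.
  have : \sum_y (s k y * (val eta (hedge k y) : nat)%:Z +
      s k y * (val eta (hedge (k - 1) y) : nat)%:Z +
      s k y * v y + s k y * v (y - 1)) = 0.
    by rewrite -[RHS](zero_r k 1); apply: eq_bigr => y _; rewrite -!mulrDr vertexE.
  rewrite !big_split /= sum_shift_r.
  have -> : \sum_y s k y * (val eta (hedge (k - 1) y) : nat)%:Z =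
    - \sum_y s (k - 1) y * (val eta (hedge (k - 1) y) : nat)%:Z.
    by rewrite -sumrN; apply: eq_bigr => y _; rewrite -mulNr -sSl subrK.
  by rewrite addrK => /eqP; rewrite subr_eq0 => /eqP ->.
rewrite -[i]natr_Zp; elim: (i : nat) => [//|k IH].
by rewrite step -natr1 addrK.
Qed.

End FluxConstant.

(* By flux1_const and flux2_const the choice of row and column is immaterial. *)
Definition slope_class L (Delta : int * int) (eta : Omega_torus L) : bool :=
  (flux1 0 eta == Delta.1) && (flux2 0 eta == Delta.2).

Definition a_edge (e : edge int) : bool :=
  let f := face_of true e in ~~ oddz f.1 && ~~ oddz f.2.
Definition num_a L (eta : Omega_torus L) : nat :=
  #|[pred e : edge 'Z_(2 * L) | val eta e && a_edge (plane_edge e)]|.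

Definition torus_gibbs (R : realType) (a : R) L (Delta : int * int)
    (eta : Omega_torus L) : R :=
  if slope_class Delta eta then
    a ^+ num_a eta /
      \sum_(xi : Omega_torus L | slope_class Delta xi) a ^+ num_a xi
  else 0.
Definition torus_mean (R : realType) (a : R) L (Delta : int * int)
    (f : Omega_torus L -> R) : R :=
  \sum_(eta : Omega_torus L) torus_gibbs a Delta eta * f eta.

Definition local_function (R : realType) (g : Omega -> R) : Prop :=
  exists E : seq (edge int), forall eta xi : Omega,
    {in E, val eta =1 val xi} -> g eta = g xi.

Definition slope_square (R : realType) : set (R * R) :=
  [set s | `|s.1| + `|s.2| <= 1].
Arguments slope_square R : clear implicits.

(* pi is the measure pi_rho of Kenyon, Okounkov and Sheffield: the limit, on  *)
(* local functions, of the torus measures along every sequence of height      *)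
(* changes Delta with Delta L / L --> rho.                                    *)
Definition slope_measure (R : realType) (a : R) (rho : R * R)
    (pi : probability Omega R) : Prop :=
  forall Delta : nat -> int * int,
    (fun L => ((Delta L).1%:~R / L%:R, (Delta L).2%:~R / L%:R) : R * R)
      @ \oo --> rho ->
  forall g : Omega -> R, local_function g ->
    (fun L => (torus_mean a (Delta L)
      (fun eta : Omega_torus L => g (periodic_lift eta)))%:E)
      @ \oo --> ('E_pi[g])%E.

(* Main.v *)
Require Import Defs.
From mathcomp Require Import all_boot all_order all_algebra.
From mathcomp Require Import finmap zify lra.
From mathcomp Require Import all_classical all_reals all_analysis.

(* On the torus the law of the configuration is a product over even faces, and
   F_0 acts on each even face by a kernel that is symmetric and sends a face
   with n dimers to one with 2 - n.  Hence F_0 turns the weight a^(N_a) into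
   a^(N_1), the weight in which the labels a and 1 are exchanged.  Seen from the
   odd faces, a^(N_1) again has parallel edges of equal weight on each face, say
   x and y with x^2 + y^2 = 1 + a^2, and the kernel of F_1 satisfies detailed
   balance for it up to a factor (1 + a^2)^(1 - n) per face; the total factor is 1
   because there are as many dimers as odd faces.  The translation by (-1, -1)
   turns a^(N_1) back into a^(N_a).  Each of F_0 and F_1 changes the sign of both
   height changes, so the torus measures of given slope are stationary.  For a
   local g, g(T(eta)) reads finitely many coins and edges, so the torus identities
   pass to the limit. *)

Set Implicit Arguments.
Unset Strict Implicit.
Unset Printing Implicit Defensive.

Import Order.TTheory GRing.Theory Num.Theory.
Import numFieldNormedType.Exports.

Local Open Scope classical_set_scope.
Local Open Scope ring_scope.

(** * Big operators over alternating classes and independent choices *)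

(** Translation by 1 maps [p] onto its complement, so each term outside [p] is paired with one
    inside. *)
Lemma big_alternating (T : Type) (idx : T) (op : Monoid.com_law idx) n
    (p : pred 'Z_n) (F : 'Z_n -> T) :
  (forall x, p (x + 1) = ~~ p x) ->
  \big[op/idx]_x F x = \big[op/idx]_(x | p x) op (F x) (F (x + 1)).
Proof.
move=> pS; rewrite (bigID p) /= big_split /=; congr (op _ _).
rewrite (reindex_inj (addIr 1)) /=; apply: eq_bigl => x.
by rewrite pS negbK.
Qed.

(** With [p] the law of independent coins and [q] one factor per coin, this is the multiplicativity
    of expectation. *)
Lemma sum_prod_ffun (R : comPzRingType) (I J : finType) (p q : I -> J -> R) :
  \sum_(c : {ffun I -> J}) (\prod_i p i (c i)) * (\prod_i q i (c i)) =
  \prod_i \sum_j p i j * q i j.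
Proof.
rewrite bigA_distr_bigA /=; apply: eq_bigr => c _.
by rewrite -big_split.
Qed.

Lemma prod_natr_bool (R : comPzSemiRingType) (I : finType) (P q : pred I) :
  \prod_(i | P i) (q i)%:R = [forall (i | P i), q i]%:R :> R.
Proof.
have [/forall_inP h|/forall_inPn[i Pi /negbTE qi]] := boolP [forall (i | P i), q i].
  by rewrite big1 // => i /h ->.
by rewrite (bigD1 i) //= qi mul0r.
Qed.

(** * States of a single face *)

Lemma even_faceE f : even_face f = (oddz f.1 == oddz f.2).
Proof. by case: f => x y; rewrite /even_face /white /oddz /=; lia. Qed.

(* Occupation of the bottom, top, left and right edges of a face. *)
Definition state : Type := (bool * bool * bool * bool)%type.

Definition state_at (G : comPzRingType) (m : edge G -> bool) (f : G * G) :
    state :=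
  (m (hedge f.1 f.2), m (hedge f.1 (f.2 + 1)),
   m (vedge f.1 f.2), m (vedge (f.1 + 1) f.2)).

Definition horizontals (s : state) : nat := let: (b, t, l, r) := s in b + t.
Definition verticals (s : state) : nat := let: (b, t, l, r) := s in l + r.
Definition dimers (s : state) : nat := horizontals s + verticals s.
Definition admissible (s : state) : bool :=
  (horizontals s == 0%N) || (verticals s == 0%N).

Definition local_update (c : bool) (s : state) : state :=
  match dimers s with
  | 0%N => (~~ c, ~~ c, c, c)
  | 1%N => let: (b, t, l, r) := s in (t, b, r, l)
  | _ => (false, false, false, false)
  end.

Lemma state_at_update ev coin m f : even_face f == ev ->
  state_at (update ev coin m) f = local_update (coin f) (state_at m f).
Proof.
move=> fev; have /= [] := updateE coin m fev.
rewrite /state_at /boundary /= /bottom_edge /top_edge /left_edge /right_edge.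
move=> -> -> -> ->; rewrite /local_update /dimers /= addn0 !addnA.
by case: (_ + _ + _ + _)%N => [|[|n]].
Qed.

(** A horizontal and a vertical edge of a face always share a corner, which cannot meet two
    dimers. *)
Lemma admissible_state_at (G : comPzRingType) (m : edge G -> bool) f :
  perfect_matching m -> admissible (state_at m f).
Proof.
case: f => x y mP; rewrite /admissible /state_at /=.
have := mP (x, y); have := mP (x + 1, y); have := mP (x, y + 1).
have := mP (x + 1, y + 1); rewrite /= !addrK.
by do 4!case: (m _) => /=; lia.
Qed.

(** * Parities, faces and edges of the torus *)

Section Torus.
Context (L : nat) (L0 : (0 < L)%N).
Local Notation Z := 'Z_(2 * L).
Local Notation tface := (Z * Z)%type.

Let castN : (Zp_trunc (2 * L)).+2 = (2 * L)%N.
Proof. by rewrite Zp_cast //; move: L0; lia. Qed.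

Lemma odd_ZpS (x : Z) : odd (x + 1)%R = ~~ odd x.
Proof.
have oddN : odd (Zp_trunc (2 * L)).+2 = false by rewrite castN oddM.
by rewrite /= odd_mod // oddD odd_mod // addbT.
Qed.

Lemma val_Zp_intr (z : int) : ((z%:~R : Z) : nat)%:Z = (z %% (2 * L)%:Z)%Z.
Proof.
have N0 : (2 * L)%:Z != 0 by move: L0; lia.
have : 0 <= (z %% (2 * L)%:Z)%Z by exact: modz_ge0.
have : (z %% (2 * L)%:Z)%Z < (2 * L)%:Z.
  by rewrite ltz_pmod //; move: L0; lia.
have zE : z%:~R = (z %% (2 * L)%:Z)%Z%:~R :> Z.
  rewrite {1}(divz_eq z (2 * L)%:Z) rmorphD rmorphM /=.
  by rewrite -pmulrn pchar_Zp ?mulr0 ?add0r//; move: L0; lia.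
rewrite zE; case: (z %% _)%Z => // n nN _.
by rewrite -pmulrn Zp_nat /= modn_small // castN.
Qed.

(** The period 2L is even, so reduction modulo the period preserves parity. *)
Lemma oddz_Zp_intr (z : int) : odd (z%:~R : Z) = oddz z.
Proof.
have := val_Zp_intr z; have := divz_eq z (2 * L)%:Z; rewrite /oddz.
set q := (z %/ _)%Z; move: (z %% _)%Z (nat_of_ord _) => r n zE nE.
(* The multiple of the period is written as twice the atom [q * L], which keeps the goal linear for
   [lia]. *)
rewrite zE -nE (_ : q * _ = 2 * (q * L)); first by lia.
by rewrite PoszM mulrCA.
Qed.

(** Two integers of absolute value less than L differ by less than the period 2L. *)
Lemma intr_Zp_inj (y z : int) : `|y| < L%:Z -> `|z| < L%:Z ->
  y%:~R = z%:~R :> Z -> y = z.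
Proof.
move=> yL zL yz.
have /eqP : (y %% (2 * L)%:Z)%Z = (z %% (2 * L)%:Z)%Z by rewrite -!val_Zp_intr yz.
rewrite eqz_mod_dvd => /dvdzP[q]; move: yL zL L0 => ? ? ? E.
have : q = 0 by nia.
by move=> q0; move: E; rewrite q0; lia.
Qed.

Definition plane_face (f : tface) : face := ((f.1 : nat)%:Z, (f.2 : nat)%:Z).
Definition torus_face (f : face) : tface := (f.1%:~R, f.2%:~R).
Definition tparity (f : tface) : bool := odd f.1 == odd f.2.

Lemma plane_faceK : cancel plane_face torus_face.
Proof. by case=> x y; rewrite /torus_face /= -!pmulrn !natr_Zp. Qed.

Lemma plane_edgeK : cancel (@plane_edge L) (@torus_edge L).
Proof. by case=> b [x y]; rewrite /torus_edge /= -!pmulrn !natr_Zp. Qed.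

Lemma tparity_torus_face f : tparity (torus_face f) = even_face f.
Proof. by rewrite /tparity !oddz_Zp_intr even_faceE. Qed.

Lemma even_plane_face f : even_face (plane_face f) = tparity f.
Proof. by rewrite -tparity_torus_face plane_faceK. Qed.

Lemma state_at_torus_edge (m : edge Z -> bool) f :
  state_at (m \o @torus_edge L) f = state_at m (torus_face f).
Proof. by rewrite /state_at /= /torus_edge /= !rmorphD. Qed.

(** Every edge bounds a face of parity [ev]: the one at its own coordinates or, failing that, the
    neighbour on the left (vertical edge) or below (horizontal edge). *)
Lemma state_at_ext ev (m m' : edge Z -> bool) :
  (forall f, tparity f == ev -> state_at m f = state_at m' f) -> m =1 m'.
Proof.
move=> E [b [x y]].
have [fev|fev] := boolP (tparity (x, y) == ev).
  by case: (E _ fev) => /=; case: b.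
case: b.
  have /E[_ _ _] : tparity (x - 1, y) == ev.
    move: fev; rewrite /tparity /= -{1}[x](subrK 1) odd_ZpS.
    by case: (ev); case: odd; case: odd.
  by rewrite /= subrK.
have /E[_ + _ _] : tparity (x, y - 1) == ev.
  move: fev; rewrite /tparity /= -{1}[y](subrK 1) odd_ZpS.
  by case: (ev); case: odd; case: odd.
by rewrite /= subrK.
Qed.

Lemma big_edges (T : Type) (idx : T) (op : Monoid.com_law idx)
    (F : edge Z -> T) :
  \big[op/idx]_e F e = op (\big[op/idx]_(f : tface) F (hedge f.1 f.2))
                          (\big[op/idx]_(f : tface) F (vedge f.1 f.2)).
Proof.
rewrite (bigID (fun e => ~~ e.1)) /=; congr (op _ _).
- rewrite (reindex_onto (fun f => (false, f)) snd) => [|[[] f]] //=.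
  by apply: eq_big => [f|[]//]; rewrite eqxx.
- rewrite (reindex_onto (fun f => (true, f)) snd) => [|[[] f]] //=.
  by apply: eq_big => [f|[]//]; rewrite eqxx.
Qed.

(** Along a column, horizontal edges are alternately bottom and top edges of faces of parity [ev];
    along a row, vertical edges are alternately left and right edges. [big_alternating] applies to
    each column and each row. *)
Lemma big_faces ev (T : Type) (idx : T) (op : Monoid.com_law idx)
    (F : edge Z -> T) :
  \big[op/idx]_e F e = \big[op/idx]_(f | tparity f == ev)
    op (op (F (hedge f.1 f.2)) (F (hedge f.1 (f.2 + 1))))
       (op (F (vedge f.1 f.2)) (F (vedge (f.1 + 1) f.2))).
Proof.
rewrite big_edges big_split /=; congr (op _ _).
- rewrite -(pair_bigA _ (fun x y => F (hedge x y))) /=.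
  rewrite (eq_bigr (fun x => \big[op/idx]_(y | tparity (x, y) == ev)
      op (F (hedge x y)) (F (hedge x (y + 1))))) => [|x _].
    by rewrite pair_big_dep.
  apply: big_alternating => y; rewrite /tparity /= odd_ZpS.
  by case: (ev); case: odd; case: odd.
- rewrite -(pair_bigA _ (fun x y => F (vedge x y))) /= exchange_big /=.
  rewrite (eq_bigr (fun y => \big[op/idx]_(x | tparity (x, y) == ev)
      op (F (vedge x y)) (F (vedge (x + 1) y)))) => [|y _].
    by rewrite (exchange_big_dep predT) //= pair_big_dep.
  apply: (@big_alternating _ _ _ _ (fun x => tparity (x, y) == ev)) => x.
  rewrite /tparity /= odd_ZpS.
  by case: (ev); case: odd; case: odd.
Qed.

End Torus.

(** * The dynamics on the torus *)

Section TorusDynamics.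
Context (L : nat) (L0 : (0 < L)%N).
Local Notation Z := 'Z_(2 * L).
Local Notation tface := (Z * Z)%type.

Definition torus_face_of (ev : bool) (e : edge Z) : tface :=
  if tparity e.2 == ev then e.2
  else if vertical e then (e.2.1 - 1, e.2.2) else (e.2.1, e.2.2 - 1).

(** An edge is the bottom or left edge of its face of parity [ev] if its own coordinates have that
    parity, and the top or right edge otherwise; hence the two signs of [u]. *)
Definition torus_opposite (ev : bool) (e : edge Z) : edge Z :=
  let u : Z := if tparity e.2 == ev then 1 else - 1 in
  if vertical e then vedge (e.2.1 + u) e.2.2 else hedge e.2.1 (e.2.2 + u).

Definition torus_update (ev : bool) (c : tface -> bool) (m : edge Z -> bool)
    (e : edge Z) : bool :=
  let f := torus_face_of ev e in
  match dimers (state_at m f) with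
  | 0%N => c f == vertical e
  | 1%N => m (torus_opposite ev e)
  | _ => false
  end.

Lemma torus_face_face_of ev e :
  torus_face L (face_of ev e) = torus_face_of ev (torus_edge L e).
Proof.
rewrite /face_of /torus_face_of (tparity_torus_face L0 e.2).
by case: ifP => // _; case: e => [[] [x y]]; rewrite /torus_face /= rmorphB.
Qed.

Lemma torus_edge_opposite ev e :
  torus_edge L (opposite (face_of ev e) e) = torus_opposite ev (torus_edge L e).
Proof.
have K (z : int) : z - 1 + 1 = z by rewrite subrK.
have D (x : int) : (x == x + 1) = false by lia.
have D' (x : int) : (x == x - 1) = false by lia.
rewrite /face_of /torus_opposite (tparity_torus_face L0 e.2).
case: ifP => // _; case: e => [[] [x y]];
  rewrite /opposite /bottom_edge /top_edge /left_edge /right_edge /=;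
  rewrite /hedge /vedge !xpair_eqE /= ?eqxx ?K ?D ?D' /= ?eqxx;
  by rewrite /torus_edge /= ?rmorphD ?rmorphB.
Qed.

(** The face of an edge, the opposite edge and the face state all commute with the projection from
    the plane. Planar facts such as [update_matching] pass to the torus through this identity. *)
Lemma torus_update_torus_edge ev c m e :
  torus_update ev c m (torus_edge L e) =
  update ev (c \o torus_face L) (m \o @torus_edge L) e.
Proof.
rewrite /torus_update /update -torus_face_face_of -torus_edge_opposite.
rewrite -state_at_torus_edge /dimers /state_at /boundary /= addn0 !addnA.
by [].
Qed.

Lemma state_at_torus_update ev c m f : tparity f == ev ->
  state_at (torus_update ev c m) f = local_update (c f) (state_at m f).
Proof.
rewrite -(plane_faceK f) tparity_torus_face // -!state_at_torus_edge => fev.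
rewrite -[c _]/((c \o torus_face L) _) -(state_at_update _ _ fev).
by rewrite /state_at /= !torus_update_torus_edge.
Qed.

Lemma perfect_matching_torus_edge (m : edge Z -> bool) :
  perfect_matching (m \o @torus_edge L) <-> perfect_matching m.
Proof.
have E v : count (m \o @torus_edge L) (incident v) =
    count m (incident (torus_face L v)).
  by rewrite /= /torus_edge /= !rmorphB.
split=> mP v; last by rewrite E.
by rewrite -[v]plane_faceK -E; apply: mP.
Qed.

Lemma torus_update_matching ev c m :
  perfect_matching m -> perfect_matching (torus_update ev c m).
Proof.
move=> /perfect_matching_torus_edge mP; apply/perfect_matching_torus_edge.
move=> v; apply: etrans (update_matching ev (c \o torus_face L) mP v).
by apply: eq_count => e; rewrite /= torus_update_torus_edge.
Qed.

Lemma torus_matchingP (m : {ffun edge Z -> bool}) :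
  reflect (perfect_matching m) (torus_matching m).
Proof. exact: 'forall_eqP. Qed.

Lemma torus_step_subproof ev (c : tface -> bool) (eta : Omega_torus L) :
  torus_matching [ffun e => torus_update ev c (val eta) e].
Proof.
apply/torus_matchingP => v.
have etaP := elimT (torus_matchingP _) (valP eta).
apply: etrans (torus_update_matching ev c etaP v).
by apply: eq_count => e; rewrite ffunE.
Qed.

Definition torus_step ev (c : tface -> bool) (eta : Omega_torus L) :
    Omega_torus L := Sub _ (torus_step_subproof ev c eta).

Lemma torus_stepE ev c eta : val (torus_step ev c eta) =1 torus_update ev c (val eta).
Proof. by move=> e; rewrite ffunE. Qed.

(** The faces of parity [ev] partition the edges, so the event splits into one condition per face,
    each involving only the coin of that face. *)
Lemma torus_step_eq ev c (eta xi : Omega_torus L) :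
  (torus_step ev c eta == xi) =
  [forall (f | tparity f == ev),
     local_update (c f) (state_at (val eta) f) == state_at (val xi) f].
Proof.
apply/eqP/forall_inP => [<- f fev|E].
  rewrite -(state_at_torus_update _ _ fev); apply/eqP.
  by rewrite /state_at !torus_stepE.
apply/val_inj/ffunP; apply: (state_at_ext L0 (ev := ev)) => f fev.
rewrite -(eqP (E f fev)) -(state_at_torus_update _ _ fev).
by rewrite /state_at !torus_stepE.
Qed.

Lemma admissible_torus (eta : Omega_torus L) f : admissible (state_at (val eta) f).
Proof. exact/admissible_state_at/torus_matchingP/valP. Qed.

(** The left side counts all dimers. Each edge has exactly one end in the colour class of the
    vertices [f] with [tparity f == ev], and each such vertex meets one dimer; these vertices are
    the lower left corners of the faces on the right side. *)
Lemma sum_dimers ev (eta : Omega_torus L) :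
  (\sum_(f | tparity f == ev) dimers (state_at (val eta) f) =
   \sum_(f : tface | tparity f == ev) 1)%N.
Proof.
have -> : (\sum_(f | tparity f == ev) dimers (state_at (val eta) f) =
    \sum_e val eta e)%N by rewrite (big_faces L0 ev).
rewrite big_edges /=.
have shift_l (F : tface -> nat) :
    (\sum_(f | tparity f != ev) F f = \sum_(f | tparity f == ev) F ((f.1 - 1)%R, f.2))%N.
  rewrite [RHS](reindex (fun f : tface => (f.1 + 1, f.2))) /=; last first.
    by exists (fun f : tface => (f.1 - 1, f.2)) => -[x y] _ /=; rewrite ?addrK ?subrK.
  apply: eq_big => [f|[x y] _]; last by rewrite /= addrK.
  by rewrite /tparity /= odd_ZpS //; case: (ev); case: odd; case: odd.
have shift_r (F : tface -> nat) :
    (\sum_(f | tparity f != ev) F f = \sum_(f | tparity f == ev) F (f.1, (f.2 - 1)%R))%N.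
  rewrite [RHS](reindex (fun f : tface => (f.1, f.2 + 1))) /=; last first.
    by exists (fun f : tface => (f.1, f.2 - 1)) => -[x y] _ /=; rewrite ?addrK ?subrK.
  apply: eq_big => [f|[x y] _]; last by rewrite /= addrK.
  by rewrite /tparity /= odd_ZpS //; case: (ev); case: odd; case: odd.
rewrite (bigID (fun f => tparity f == ev)) /= shift_l.
rewrite [X in (_ + X)%N](bigID (fun f => tparity f == ev)) /= shift_r.
rewrite -!big_split /=; apply: eq_bigr => f _.
have /torus_matchingP/(_ f) /= := valP eta.
by rewrite addn0 !addnA.
Qed.

End TorusDynamics.

(** * The transition kernel of one face *)

Definition coin_prob (R : pzRingType) (v : R) (b : bool) : R :=
  if b then v else 1 - v.

Definition local_kernel (R : pzRingType) (v : R) (s s' : state) : R :=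
  \sum_b coin_prob v b * (local_update b s == s')%:R.

Lemma sum_coin_prob (R : pzRingType) (v : R) : \sum_b coin_prob v b = 1.
Proof. by rewrite big_bool /= subrKC. Qed.

(* The factor C ^+ dimers s' keeps the exponent of C nonnegative. *)
Lemma local_balance (R : realFieldType) (x y C v : R) s s' :
  x ^+ 2 + y ^+ 2 = C -> v * C = y ^+ 2 -> admissible s -> admissible s' ->
  C ^+ dimers s' * (x ^+ horizontals s * y ^+ verticals s) *
    local_kernel v s s' =
  C * (x ^+ horizontals s' * y ^+ verticals s') * local_kernel v s' s.
Proof.
(* Balancing the creation of a vertical pair with its deletion reads [C ^+ 2 * v = C * y ^+ 2],
   which is [vC] multiplied by [C]. *)
move=> xyC vC; have vC2 : v * C * C = y ^+ 2 * C by rewrite vC.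
case: s s' => [[[b t] l] r] [[[b' t'] l'] r'].
rewrite /local_kernel !big_bool /= /coin_prob.
case: b; case: t; case: l; case: r => //;
  case: b'; case: t'; case: l'; case: r' => //;
  rewrite /local_update /dimers /= => _ _;
  rewrite ?xpair_eqE /= ?(mulr0, mulr1, addr0, add0r) ?expr0 ?expr1 ?mulr1;
  rewrite ?mul1r // -?xyC in vC vC2 *; lra.
Qed.

Lemma dimers_local_update c s :
  admissible s -> (dimers s + dimers (local_update c s) = 2)%N.
Proof. by case: s c => [[[[] []] []] []] []. Qed.

(** Sliding exchanges opposite edges, while before and after a creation or a deletion opposite edges
    are equally occupied and all differences vanish. *)
Lemma flux_local_update c s : admissible s ->
  let: (b, t, l, r) := s in let: (b', t', l', r') := local_update c s in
  (b%:Z - t%:Z = t'%:Z - b'%:Z) /\ (l%:Z - r%:Z = r'%:Z - l'%:Z) :> Prop.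
Proof. by case: s c => [[[[] []] []] []] []. Qed.

(** * The transition kernels of the two half steps on the torus *)

Section StepKernel.
Context (R : realType) (a : R).
Context (L : nat) (L0 : (0 < L)%N).
Local Notation Z := 'Z_(2 * L).
Local Notation tface := (Z * Z)%type.
Implicit Types eta xi : Omega_torus L.

Definition tprob (f : tface) : R := vertical_prob a (plane_face f).

Definition coins_prob (c : {ffun tface -> bool}) : R :=
  \prod_f coin_prob (tprob f) (c f).

Definition step_kernel ev eta xi : R := \prod_(f | tparity f == ev)
  local_kernel (tprob f) (state_at (val eta) f) (state_at (val xi) f).

Let indicator ev c eta xi : (torus_step L0 ev c eta == xi)%:R =
  \prod_(f | tparity f == ev)
    (local_update (c f) (state_at (val eta) f) == state_at (val xi) f)%:R :> R.
Proof. by rewrite torus_step_eq prod_natr_bool. Qed.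

(** The indicator factors over the faces of parity [ev]; the coins of the other faces sum out to
    1. *)
Lemma step_kernelE ev eta xi : step_kernel ev eta xi =
  \sum_c coins_prob c * (torus_step L0 ev c eta == xi)%:R.
Proof.
pose q f b : R := if tparity f == ev then
  (local_update b (state_at (val eta) f) == state_at (val xi) f)%:R else 1.
under [RHS]eq_bigr => c _ do rewrite indicator big_mkcond.
rewrite (sum_prod_ffun (fun f => coin_prob (tprob f)) q) /step_kernel big_mkcond.
apply: eq_bigr => f _; rewrite /q; case: ifP => // _.
by under eq_bigr do rewrite mulr1; rewrite sum_coin_prob.
Qed.

Lemma sum_coins_prob : \sum_c coins_prob c = 1.
Proof.
rewrite -(bigA_distr_bigA (fun f => coin_prob (tprob f))) big1 // => f _.
exact: sum_coin_prob.
Qed.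

Lemma sum_step_kernel ev eta : \sum_xi step_kernel ev eta xi = 1.
Proof.
under eq_bigr do rewrite step_kernelE.
rewrite exchange_big /= -[RHS]sum_coins_prob; apply: eq_bigr => c _.
rewrite (bigD1 (torus_step L0 ev c eta)) //= eqxx mulr1.
by rewrite big1 ?addr0 // => xi; rewrite eq_sym => /negbTE ->; rewrite mulr0.
Qed.

(** Turns a relation between [eta] and [torus_step] valid for all coins into an identity between
    functions multiplied by the kernel. *)
Lemma step_kernel_neq0 ev eta xi :
  step_kernel ev eta xi != 0 -> exists c, torus_step L0 ev c eta = xi.
Proof.
rewrite step_kernelE; have [/existsP[c /eqP cE] _|] :=
  boolP [exists c : {ffun tface -> bool}, torus_step L0 ev c eta == xi].
  by exists c.
move=> /existsPn h; rewrite big1 ?eqxx // => c _.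
by rewrite (negbTE (h c)) mulr0.
Qed.

(** Both half steps use the same family [c], but the first reads only even faces and the second only
    odd ones, so the two kernels multiply as for independent coins. *)
Lemma two_step_mean (h : Omega_torus L -> R) eta :
  \sum_c coins_prob c * h (torus_step L0 false c (torus_step L0 true c eta)) =
  \sum_xi \sum_zeta step_kernel true eta xi * step_kernel false xi zeta * h zeta.
Proof.
have E xi zeta : step_kernel true eta xi * step_kernel false xi zeta =
    \sum_c coins_prob c * ((torus_step L0 true c eta == xi)%:R *
      (torus_step L0 false c xi == zeta)%:R).
  pose q f b : R := if tparity f == true then
    (local_update b (state_at (val eta) f) == state_at (val xi) f)%:R else
    (local_update b (state_at (val xi) f) == state_at (val zeta) f)%:R.
  have F (G : tface -> R) : \prod_(f | tparity f == false) G f =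
      \prod_(f | tparity f != true) G f by apply: eq_bigl => f; case: tparity.
  transitivity (\prod_f \sum_b coin_prob (tprob f) b * q f b).
    rewrite /step_kernel F [RHS](bigID (fun f => tparity f == true)) /=.
    by congr (_ * _); apply: eq_bigr => f; rewrite /q; case: eqP.
  rewrite -(sum_prod_ffun (fun f => coin_prob (tprob f)) q).
  apply: eq_bigr => c _; congr (_ * _); rewrite !indicator F.
  rewrite [LHS](bigID (fun f => tparity f == true)) /=.
  by congr (_ * _); apply: eq_bigr => f; rewrite /q; case: eqP.
under [RHS]eq_bigr do under eq_bigr do rewrite E mulr_suml.
under [RHS]eq_bigr do rewrite exchange_big /=.
rewrite exchange_big /=; apply: eq_bigr => c _.
rewrite (bigD1 (torus_step L0 true c eta)) //=.
rewrite [X in _ + X]big1 ?addr0 => [|xi]; last first.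
  by rewrite eq_sym => /negbTE ->; rewrite big1 // => ? _; rewrite mul0r mulr0 mul0r.
rewrite (bigD1 (torus_step L0 false c (torus_step L0 true c eta))) //= !eqxx !mulr1.
by rewrite big1 ?addr0 // => xi; rewrite eq_sym => /negbTE ->; rewrite !mulr0 mul0r.
Qed.

Lemma step_kernel_balance ev (x y : tface -> R) (C : R) eta xi : C != 0 ->
  (forall f, tparity f == ev -> x f ^+ 2 + y f ^+ 2 = C) ->
  (forall f, tparity f == ev -> tprob f * C = y f ^+ 2) ->
  let w (zeta : Omega_torus L) := \prod_(f | tparity f == ev)
    (x f ^+ horizontals (state_at (val zeta) f) *
     y f ^+ verticals (state_at (val zeta) f)) in
  w eta * step_kernel ev eta xi = w xi * step_kernel ev xi eta.
Proof.
move=> C0 xyC vC w.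
have P0 : \prod_(f : tface | tparity f == ev) C != 0.
  by apply/prodf_neq0.
(* Both sides receive one factor [C] per face of parity [ev]. On the left, [sum_dimers]
   redistributes these factors as [C ^+ dimers] of the states of [xi], the form required by
   [local_balance]. *)
apply: (mulfI P0).
have {1}-> : \prod_(f : tface | tparity f == ev) C =
    \prod_(f | tparity f == ev) C ^+ dimers (state_at (val xi) f).
  rewrite prodrXr sum_dimers // -prodrXr.
  by apply: eq_bigr.
rewrite /w /step_kernel -!big_split /=; apply: eq_bigr => f fev.
rewrite [LHS]mulrA [RHS]mulrA.
exact: (local_balance (xyC _ fev) (vC _ fev) (admissible_torus eta f)
  (admissible_torus xi f)).
Qed.

End StepKernel.

(** * Weights and height changes under the half steps and the translation *)

Section TorusInvariants.
Context (L : nat) (L0 : (0 < L)%N).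
Local Notation Z := 'Z_(2 * L).
Local Notation tface := (Z * Z)%type.
Implicit Types eta xi : Omega_torus L.

Definition a_face (f : tface) : bool := ~~ odd f.1 && ~~ odd f.2.

Lemma a_edge_plane_edge (e : edge Z) :
  a_edge (plane_edge e) = a_face (torus_face_of true e).
Proof.
rewrite -{2}(plane_edgeK e) -torus_face_face_of // /a_edge /a_face /=.
by rewrite !oddz_Zp_intr.
Qed.

Definition num_1 eta : nat :=
  #|[pred e : edge Z | val eta e && ~~ a_edge (plane_edge e)]|.

(** All four edges of an even face carry its label. Taking [p] to be [id] gives [num_a], and [negb]
    gives [num_1]. *)
Lemma card_edges_even (p : pred bool) eta :
  #|[pred e : edge Z | val eta e && p (a_edge (plane_edge e))]| =
  (\sum_(f | tparity f == true) p (a_face f) * dimers (state_at (val eta) f))%N.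
Proof.
rewrite -sum1_card big_mkcond /= (big_faces L0 true).
apply: eq_bigr => -[x y] fev; rewrite !inE !a_edge_plane_edge /torus_face_of /= fev.
have -> : (tparity (x, y + 1) == true) = false.
  by move: fev; rewrite /tparity /= odd_ZpS //; case: odd; case: odd.
have -> : (tparity (x + 1, y) == true) = false.
  by move: fev; rewrite /tparity /= odd_ZpS //; case: odd; case: odd.
rewrite !addrK.
by case: (p _); rewrite ?andbT ?andbF ?mul1n ?mul0n //; do 4!case: (sval eta _).
Qed.

(** The even faces above and below an odd face [f] have both coordinates of the parity of [f.1],
    those on its sides both of the other parity. Hence its horizontal edges have weight a if [f.1]
    is even, and its vertical edges if [f.1] is odd. *)
Lemma card_edges_odd (p : pred bool) eta :
  #|[pred e : edge Z | val eta e && p (a_edge (plane_edge e))]| =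
  (\sum_(f | tparity f == false)
     (p (~~ odd f.1) * horizontals (state_at (val eta) f) +
      p (odd f.1) * verticals (state_at (val eta) f)))%N.
Proof.
rewrite -sum1_card big_mkcond /= (big_faces L0 false).
apply: eq_bigr => -[x y] fev; rewrite !inE !a_edge_plane_edge /torus_face_of /=.
have -> : (tparity (x, y) == true) = false by case: tparity fev.
have -> : (tparity (x, y + 1) == true).
  by move: fev; rewrite /tparity /= odd_ZpS //; case: odd; case: odd.
have -> : (tparity (x + 1, y) == true).
  by move: fev; rewrite /tparity /= odd_ZpS //; case: odd; case: odd.
have oddB (z : Z) : odd (z - 1)%R = ~~ odd z.
  by rewrite -{2}(subrK 1 z) odd_ZpS // negbK.
rewrite /a_face /= !odd_ZpS // !oddB.
have -> : odd y = ~~ odd x.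
  by move: fev; rewrite /tparity /=; case: odd; case: odd.
rewrite !negbK !andbb.
by case: (odd x) => /=; do 2!case: (p _) => /=; rewrite ?andbT ?andbF ?mul1n ?mul0n //;
  do 4!case: (sval eta _).
Qed.

Lemma state_at_step ev c eta f : tparity f == ev ->
  state_at (val (torus_step L0 ev c eta)) f =
  local_update (c f) (state_at (val eta) f).
Proof.
move=> fev; have /eqP := erefl (torus_step L0 ev c eta).
by rewrite {1}torus_step_eq => /forall_inP/(_ f fev)/eqP.
Qed.

(** The translation by (1, 1) preserves the parity of faces and exchanges the two labels of the even
    faces. *)
Lemma reindex_diagonal (F : tface -> nat) (P : pred tface) :
  (\sum_(f | P f) F f = \sum_(f | P (f.1 + 1, f.2 + 1)%R) F (f.1 + 1, f.2 + 1)%R)%N.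
Proof.
rewrite (reindex (fun f : tface => (f.1 + 1, f.2 + 1)%R)) //=.
by exists (fun f : tface => (f.1 - 1, f.2 - 1)) => -[x y] _ /=; rewrite ?addrK ?subrK.
Qed.

(** On an a-face the dimers before and after add up to 2, so [num_a eta + num_a xi] is twice the
    number of a-faces. This is the number of even faces, hence by [sum_dimers] the number
    [num_1 xi + num_a xi] of all dimers. *)
Lemma num_a_step c eta : num_a eta = num_1 (torus_step L0 true c eta).
Proof.
move: (torus_step _ _ _ _) (state_at_step (ev := true) c eta) => xi xiE.
have : (num_a eta + num_a xi = num_1 xi + num_a xi)%N; last by lia.
(* Exactly half of the even faces are labelled a, by the diagonal translation. *)
have even2 : (\sum_(f : tface | tparity f == true) 1 =
    \sum_(f : tface | tparity f == true) (a_face f) * 2)%N.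
  transitivity (\sum_(f : tface | tparity f == true) (a_face f + ~~ a_face f))%N.
    by apply: eq_bigr => f _; case: a_face.
  under [RHS]eq_bigr do rewrite muln2 -addnn.
  rewrite !big_split /=; congr (_ + _)%N.
  rewrite [RHS]reindex_diagonal; apply: eq_big => f.
    by rewrite /tparity /= !odd_ZpS //; case: odd; case: odd.
  rewrite /a_face /tparity /= !odd_ZpS //; case: odd; case: odd => //.
rewrite /num_a /num_1 !(card_edges_even id, card_edges_even negb) -!big_split.
transitivity (\sum_(f : tface | tparity f == true) (a_face f) * 2)%N.
  apply: eq_bigr => f fev.
  rewrite -[LHS]/(a_face f * dimers (state_at (val eta) f) +
    a_face f * dimers (state_at (val xi) f))%N -mulnDr; congr (_ * _)%N.
  rewrite xiE //; exact: dimers_local_update (admissible_torus eta f).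
rewrite -even2 -(sum_dimers L0 true xi); apply: eq_bigr => f _.
by case: a_face => /=; rewrite ?mul1n ?mul0n ?addn0.
Qed.

(** Grouped by the faces of parity [ev] on the path, the flux is a signed sum of differences between
    opposite edges, and [flux_local_update] reverses each difference. *)
Lemma flux_step ev c eta : flux1 0 (torus_step L0 ev c eta) = - flux1 0 eta /\
  flux2 0 (torus_step L0 ev c eta) = - flux2 0 eta.
Proof.
pose s (x : Z) : int := sign (~~ odd x).
have sS x : s (x + 1) = - s x by rewrite /s odd_ZpS //; case: odd.
have E1 xi : flux1 0 xi = \sum_(x | tparity (x, 0 : Z) == ev)
   s x * ((val xi (vedge x 0))%:Z - (val xi (vedge (x + 1) 0))%:Z).
  transitivity (\sum_x s x * (val xi (vedge x 0))%:Z).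
    rewrite /flux1 big_mkcond; apply: eq_bigr => x _.
    case: (val xi _); rewrite ?mulr0 ?mulr1 // /s.
    by congr sign; rewrite /white /oddz /=; lia.
  rewrite (@big_alternating _ _ _ _ (fun x => tparity (x, 0 : Z) == ev)) => [|x].
    by apply: eq_bigr => x _; rewrite sS mulrBr mulNr.
  by rewrite /tparity /= odd_ZpS //; case: (ev); case: odd.
have E2 xi : flux2 0 xi = - \sum_(y | tparity (0 : Z, y) == ev)
   s y * ((val xi (hedge 0 y))%:Z - (val xi (hedge 0 (y + 1)))%:Z).
  transitivity (- \sum_y s y * (val xi (hedge 0 y))%:Z).
    rewrite /flux2 big_mkcond -sumrN; apply: eq_bigr => y _.
    case: (val xi _); rewrite ?mulr0 ?oppr0 ?mulr1 // /s.
    have -> : white ((((0%R : Z) : nat) + 1)%N%:Z, (y : nat)%:Z) = odd y.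
      by rewrite /white /oddz /=; lia.
    by case: odd.
  rewrite (@big_alternating _ _ _ _ (fun y => tparity (0 : Z, y) == ev)) => [|y].
    by congr (- _); apply: eq_bigr => y _; rewrite sS mulrBr mulNr.
  by rewrite /tparity /= odd_ZpS //; case: (ev); case: odd.
split; [rewrite !E1|rewrite !E2; congr (- _)]; rewrite -sumrN; apply: eq_bigr => z zev.
- have := flux_local_update (c (z, 0)) (admissible_torus eta (z, 0)).
  rewrite -(state_at_step c eta zev) => -[_ E].
  by rewrite -mulrN; congr (_ * _); rewrite -[LHS]opprB -[X in - X]E.
- have := flux_local_update (c (0, z)) (admissible_torus eta (0, z)).
  rewrite -(state_at_step c eta zev) => -[E _].
  by rewrite -mulrN; congr (_ * _); rewrite -[LHS]opprB -[X in - X]E.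
Qed.

Lemma torus_shift_subproof eta :
  torus_matching [ffun e : edge Z => val eta (e.1, (e.2.1 + 1, e.2.2 + 1))].
Proof.
apply/torus_matchingP => -[x y].
have /torus_matchingP/(_ (x + 1, y + 1)) := valP eta.
by apply: etrans; rewrite /= !ffunE /= !subrK !addrK.
Qed.

Definition torus_shift eta : Omega_torus L := Sub _ (torus_shift_subproof eta).

Lemma torus_shift_bij : bijective torus_shift.
Proof.
apply: injF_bij => eta xi /(congr1 val)/ffunP E; apply/val_inj/ffunP => -[b [x y]].
by have := E (b, (x - 1, y - 1)); rewrite !ffunE /= !subrK.
Qed.

Lemma num_a_shift eta : num_a (torus_shift eta) = num_1 eta.
Proof.
rewrite /num_a /num_1 (card_edges_even id) (card_edges_even negb).
rewrite [RHS]reindex_diagonal; apply: eq_big => [f|f fev].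
  by rewrite /tparity /= !odd_ZpS //; case: odd; case: odd.
congr (_ * _)%N; last by rewrite /dimers /= !ffunE.
rewrite /a_face /= !odd_ZpS //; move: fev; rewrite /tparity.
by case: odd; case: odd.
Qed.

(** The translation moves the reference row or column from 0 to 1, which is harmless by
    [flux1_const] and [flux2_const]; being diagonal, it preserves the colours and thus the signs. *)
Lemma flux_shift eta : flux1 0 (torus_shift eta) = flux1 0 eta /\
  flux2 0 (torus_shift eta) = flux2 0 eta.
Proof.
have whiteE (x y : nat) : white (x%:Z, y%:Z) = (odd x == odd y).
  by rewrite /white /oddz /=; lia.
have odd1 : odd (1%R : Z) by rewrite -[1]add0r odd_ZpS.
split.
- rewrite -(flux1_const L0 eta 1) /flux1 [RHS](reindex_inj (addIr 1)) /=.
  apply: eq_big => [x|x _]; first by rewrite ffunE /= add0r.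
  by rewrite !whiteE odd1 odd_ZpS //; case: odd.
- rewrite -(flux2_const L0 eta 1) /flux2 [RHS](reindex_inj (addIr 1)) /=.
  apply: eq_big => [x|x _]; first by rewrite ffunE /= add0r.
  by rewrite !whiteE !oddD odd1 odd_ZpS //=; case: (odd x).
Qed.

End TorusInvariants.

(** * Stationarity of the torus measures of given height change *)

Section TorusStationarity.
Context (R : realType) (a : R) (a0 : 0 < a) (L : nat) (L0 : (0 < L)%N).
Local Notation Z := 'Z_(2 * L).
Local Notation tface := (Z * Z)%type.
Implicit Types (eta xi : Omega_torus L) (c : {ffun tface -> bool}).

Definition torus_dynamics c eta : Omega_torus L :=
  torus_shift (torus_step L0 false c (torus_step L0 true c eta)).

(** Balance for the uniform weight: [x = y = 1] and [C = 2] fit the fair coin of the even faces. *)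
Lemma even_kernel_sym eta xi : step_kernel a true eta xi = step_kernel a true xi eta.
Proof.
have /= := @step_kernel_balance R a L L0 true (fun=> 1) (fun=> 1) 2 eta xi.
rewrite !big1 => [|? _|? _]; rewrite ?expr1n ?mul1r //.
apply=> // f /eqP fev.
by rewrite /tprob /vertical_prob even_plane_face // fev mulVf.
Qed.

(** By [card_edges_odd], the exchanged weight puts a on the horizontal edges of [f] when [f.1] is
    odd and on the vertical ones otherwise. With [C = 1 + a ^+ 2], the creation probability of a
    vertical pair is the squared vertical weight over [C]. *)
Lemma odd_kernel_balance eta xi :
  a ^+ num_1 eta * step_kernel a false eta xi =
  a ^+ num_1 xi * step_kernel a false xi eta.
Proof.
have C0 : 1 + a ^+ 2 != 0 by rewrite gt_eqF// ltr_wpDr// sqr_ge0.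
have wE zeta : a ^+ num_1 zeta = \prod_(f : tface | tparity f == false)
    ((if odd f.1 then a else 1) ^+ horizontals (state_at (val zeta) f) *
     (if odd f.1 then 1 else a) ^+ verticals (state_at (val zeta) f)).
  rewrite /num_1 (card_edges_odd L0 negb) -prodrXr; apply: eq_bigr => f _.
  rewrite exprD negbK; case: odd; rewrite ?mul1n ?mul0n ?expr1n ?expr0 //.
rewrite !wE; apply: (@step_kernel_balance R a L L0 false
  (fun f => if odd f.1 then a else 1) (fun f => if odd f.1 then 1 else a) _ eta xi C0) => f /eqP fev.
  by case: odd; rewrite expr1n // addrC.
rewrite /tprob /vertical_prob even_plane_face // fev.
have -> : oddz (plane_face f).1 = odd f.1 by rewrite /oddz /=; lia.
by case: odd; rewrite ?expr1n ?mulVf // divfK.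
Qed.

Lemma torus_gibbs_stationary (Delta : int * int) (h : Omega_torus L -> R) :
  torus_mean a Delta (fun eta =>
    \sum_c coins_prob a c * h (torus_dynamics c eta)) = torus_mean a Delta h.
Proof.
pose S (D : int * int) eta : R := (slope_class D eta)%:R.
(* The height changes between the half steps: the even step reverses both signs and the odd step
   restores them. *)
pose ND : int * int := (- Delta.1, - Delta.2).
have slope_step ev (c : tface -> bool) D eta : slope_class D (torus_step L0 ev c eta) =
    slope_class (- D.1, - D.2) eta.
  rewrite /slope_class; have [-> ->] := flux_step L0 ev c eta.
  by rewrite !eqr_oppLR.
have kS ev D eta xi : S D eta * step_kernel a ev eta xi =
    S (- D.1, - D.2) xi * step_kernel a ev eta xi.
  have [->|/(step_kernel_neq0 L0)[c <-]] := eqVneq (step_kernel a ev eta xi) 0.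
    by rewrite !mulr0.
  by rewrite /S slope_step /= !opprK -surjective_pairing.
have kW eta xi : a ^+ num_a eta * step_kernel a true eta xi =
    a ^+ num_1 xi * step_kernel a true eta xi.
  have [->|/(step_kernel_neq0 L0)[c <-]] := eqVneq (step_kernel a true eta xi) 0.
    by rewrite !mulr0.
  by rewrite -num_a_step.
pose Zn : R := \sum_(xi : Omega_torus L | slope_class Delta xi) a ^+ num_a xi.
have meanE f : torus_mean a Delta f =
    (\sum_eta S Delta eta * a ^+ num_a eta * f eta) / Zn.
  rewrite /torus_mean mulr_suml; apply: eq_bigr => eta _.
  rewrite /torus_gibbs /S; case: slope_class; last by rewrite !mul0r.
  by rewrite mul1r mulrAC.
rewrite !meanE; congr (_ / _).
pose g := h \o torus_shift (L := L).
have step0 eta xi : S Delta eta * a ^+ num_a eta * step_kernel a true eta xi =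
    S ND xi * a ^+ num_1 xi * step_kernel a true xi eta.
  by rewrite -mulrA kW mulrCA kS mulrCA mulrA even_kernel_sym.
have step1 xi zeta : S ND xi * a ^+ num_1 xi * step_kernel a false xi zeta =
    S Delta zeta * a ^+ num_1 zeta * step_kernel a false zeta xi.
  rewrite -mulrA odd_kernel_balance mulrCA -[RHS]mulrA [RHS]mulrCA; congr (_ * _).
  have := kS false Delta zeta xi; rewrite -/ND => ->.
  by [].
(* The two balance identities reverse the path, which now starts at [zeta]; the sums over [eta] and
   [xi] become total masses of kernels, equal to 1. *)
transitivity (\sum_eta \sum_xi \sum_zeta S Delta zeta * a ^+ num_1 zeta * g zeta *
    (step_kernel a false zeta xi * step_kernel a true xi eta)).
  apply: eq_bigr => eta _; rewrite (two_step_mean a L0 g) mulr_sumr.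
  apply: eq_bigr => xi _; rewrite mulr_sumr; apply: eq_bigr => zeta _.
  by rewrite !mulrA step0 [X in X * g _]mulrAC step1 [LHS]mulrAC [X in X * _]mulrAC.
transitivity (\sum_zeta S Delta zeta * a ^+ num_1 zeta * g zeta).
  under eq_bigr do rewrite exchange_big /=.
  rewrite exchange_big /=; apply: eq_bigr => zeta _.
  under eq_bigr do rewrite -mulr_sumr; rewrite -mulr_sumr exchange_big /=.
  under eq_bigr do rewrite -mulr_sumr sum_step_kernel // mulr1.
  by rewrite sum_step_kernel // mulr1.
(* The translation turns [num_1] into [num_a] and keeps the slope class, so it is used to reindex
   the right side. *)
have [shiftV shiftK shiftVK] := torus_shift_bij L.
rewrite [RHS](reindex (@torus_shift L)) /=; last by exists shiftV => x _.
apply: eq_bigr => eta _; rewrite num_a_shift // /S /slope_class.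
by have [-> ->] := flux_shift L0 eta.
Qed.


End TorusStationarity.

(** * Locality, and coins of the plane seen on the torus *)

(** Coins outside the image of [iota] sum out to 1; injectivity keeps the coins read by distinct [k]
    independent. *)
Lemma marginal_coins (R : comPzRingType) (K F : finType) (iota : K -> F)
    (v : F -> R) (h : {ffun K -> bool} -> R) : injective iota ->
  \sum_(c : {ffun F -> bool})
    (\prod_f coin_prob (v f) (c f)) * h [ffun k => c (iota k)] =
  \sum_(c : {ffun K -> bool}) (\prod_k coin_prob (v (iota k)) (c k)) * h c.
Proof.
move=> iota_inj.
(* At [iota k] this factor forces the coin to equal [d k]; off the image of [iota] it is an empty
   product. *)
pose q (d : {ffun K -> bool}) f b : R := \prod_(k | iota k == f) (b == d k)%:R.
have indicator (c : {ffun F -> bool}) (d : {ffun K -> bool}) :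
    \prod_f q d f (c f) = ([ffun k => c (iota k)] == d)%:R.
  transitivity (\prod_k (c (iota k) == d k)%:R : R).
    rewrite [RHS](partition_big iota predT) //=; apply: eq_bigr => f _.
    by apply: eq_bigr => k /eqP <-.
  rewrite prod_natr_bool; congr (_%:R); congr (nat_of_bool _).
  apply/forall_inP/eqP => [E|<- k _]; last by rewrite ffunE.
  by apply/ffunP => k; rewrite ffunE; apply/eqP/E.
transitivity (\sum_(d : {ffun K -> bool}) (\sum_(c : {ffun F -> bool})
    (\prod_f coin_prob (v f) (c f)) * \prod_f q d f (c f)) * h d).
  under [RHS]eq_bigr do rewrite mulr_suml.
  rewrite [RHS]exchange_big; apply: eq_bigr => c _ /=.
  rewrite (bigD1 [ffun k => c (iota k)]) //= indicator eqxx mulr1.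
  rewrite [X in _ + X]big1 ?addr0 // => d; rewrite indicator eq_sym => /negbTE ->.
  by rewrite mulr0 mul0r.
apply: eq_bigr => d _; congr (_ * _).
rewrite (sum_prod_ffun (fun f => coin_prob (v f)) (q d)).
rewrite [RHS](partition_big iota predT) //=; apply: eq_bigr => f _.
have [/existsP[k0 /eqP <-]|/existsPn k0] := boolP [exists k, iota k == f].
  have eq_k0 k : (iota k == iota k0) = (k == k0) by rewrite (inj_eq iota_inj).
  rewrite (eq_bigl _ _ eq_k0) big_pred1_eq big_bool /q !(eq_bigl _ _ eq_k0).
  rewrite !big_pred1_eq /=; case: (d k0) => /=;
  by rewrite !(mulr0, mulr1, addr0, add0r).
rewrite [RHS]big_pred0 => [|k]; last exact/negbTE/k0.
rewrite -[RHS](sum_coin_prob (v f)); apply: eq_bigr => b _.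
by rewrite /q big_pred0 ?mulr1 // => k; apply/negbTE/k0.
Qed.

Lemma mem_opposite f e : opposite f e \in boundary f.
Proof. by rewrite /opposite /boundary; do 3?case: ifP; rewrite !inE eqxx ?orbT. Qed.

Lemma update_local ev coin coin' m m' e :
  coin (face_of ev e) = coin' (face_of ev e) ->
  {in boundary (face_of ev e), m =1 m'} ->
  update ev coin m e = update ev coin' m' e.
Proof.
rewrite /update => -> mm'; rewrite (mm' _ (mem_opposite _ _)).
by rewrite (eq_in_count mm').
Qed.

(** Dependence is traced backwards: each edge read after a half step needs one coin and the four
    edges of one face before it. [E1], [E2] and [E3] are the edges read before the translation, the
    odd step and the even step. *)
Lemma Tmap_local (T : Type) (g : Omega -> T) (E : seq (edge int)) :
  (forall eta xi : Omega, {in E, val eta =1 val xi} -> g eta = g xi) ->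
  exists (K : seq face) (E' : seq (edge int)),
  forall coin coin' eta xi, {in K, coin =1 coin'} ->
    {in E', val eta =1 val xi} -> g (Tmap coin eta) = g (Tmap coin' xi).
Proof.
move=> gE.
pose E1 : seq (edge int) := [seq (e.1, (e.2.1 - -1, e.2.2 - -1)) | e <- E].
pose E2 := flatten [seq boundary (face_of false e) | e <- E1].
pose E3 := flatten [seq boundary (face_of true e) | e <- E2].
exists ([seq face_of false e | e <- E1] ++ [seq face_of true e | e <- E2]), E3.
move=> coin coin' eta xi cc' ee'; apply: gE => e eE.
set e1 := (e.1, (e.2.1 - -1, e.2.2 - -1)).
have e1E : e1 \in E1 by apply/mapP; exists e.
rewrite -[LHS]/(update false coin (update true coin (val eta)) e1).
rewrite -[RHS]/(update false coin' (update true coin' (val xi)) e1).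
apply: update_local; first by rewrite cc' // mem_cat map_f.
move=> e2 e2E; have {}e2E : e2 \in E2.
  by apply/flatten_mapP; exists e1.
apply: update_local; first by rewrite cc' // mem_cat orbC map_f.
move=> e3 e3E; apply: ee'.
by apply/flatten_mapP; exists e2.
Qed.

Section PlaneCoins.
Context (R : realType) (a : R).

(* Faces outside K receive the junk coin false. *)
Definition extend_coins (K : {fset face}) (c : {ffun K -> bool}) (f : face) :
    bool := if insub f is Some k then c k else false.

Definition plane_coins_prob (K : {fset face}) (c : {ffun K -> bool}) : R :=
  \prod_k coin_prob (vertical_prob a (val k)) (c k).

Lemma val_Tmap_periodic_lift L (L0 : (0 < L)%N)
    (c : {ffun 'Z_(2 * L) * 'Z_(2 * L) -> bool}) (eta : Omega_torus L) :
  val (Tmap (c \o @torus_face L) (periodic_lift eta)) =1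
  val (periodic_lift (torus_dynamics L0 c eta)).
Proof.
move=> e; set e1 := (e.1, (e.2.1 - -1, e.2.2 - -1)).
rewrite -[LHS]/(update false (c \o @torus_face L)
  (update true (c \o @torus_face L) (val eta \o @torus_edge L)) e1).
rewrite -[RHS]/(val (torus_dynamics L0 c eta) (torus_edge L e)) ffunE.
have -> : ((torus_edge L e).1,
    ((torus_edge L e).2.1 + 1, (torus_edge L e).2.2 + 1)) = torus_edge L e1.
  by rewrite /torus_edge /= !rmorphB /= !opprK.
rewrite torus_stepE torus_update_torus_edge //.
apply: update_local => // e2 _.
rewrite -[RHS]/(val (torus_step L0 true c eta) (torus_edge L e2)).
by rewrite torus_stepE torus_update_torus_edge.
Qed.

Lemma vertical_prob_torus_face L (L0 : (0 < L)%N) f :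
  tprob a (torus_face L f) = vertical_prob a f.
Proof.
rewrite /tprob /vertical_prob even_plane_face // tparity_torus_face //.
suff -> : oddz (plane_face (torus_face L f)).1 = oddz f.1 by [].
by rewrite -(oddz_Zp_intr L0 f.1) /oddz /=; lia.
Qed.

(** When the faces of [K] remain distinct on the torus, [marginal_coins] lets torus coins replace
    the independent planar ones, and [torus_gibbs_stationary] applies. *)
Lemma torus_mean_Tmap (a0 : 0 < a) L (L0 : (0 < L)%N) (Delta : int * int)
    (K : {fset face}) (E E' : seq (edge int)) (g : Omega -> R) :
  (forall eta xi : Omega, {in E, val eta =1 val xi} -> g eta = g xi) ->
  (forall coin coin' eta xi, {in K, coin =1 coin'} ->
    {in E', val eta =1 val xi} -> g (Tmap coin eta) = g (Tmap coin' xi)) ->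
  {in K &, injective (torus_face L)} ->
  \sum_(c : {ffun K -> bool}) plane_coins_prob c * torus_mean a Delta
    (fun eta : Omega_torus L => g (Tmap (extend_coins c) (periodic_lift eta))) =
  torus_mean a Delta (fun eta : Omega_torus L => g (periodic_lift eta)).
Proof.
move=> gE gK K_inj.
rewrite -(torus_gibbs_stationary a0 L0 Delta (fun eta => g (periodic_lift eta))).
rewrite /torus_mean.
under eq_bigr do rewrite mulr_sumr.
rewrite exchange_big; apply: eq_bigr => eta _ /=.
under eq_bigr do rewrite mulrCA; rewrite -mulr_sumr; congr (_ * _).
pose iota (k : K) := torus_face L (val k).
have iota_inj : injective iota.
  by move=> k k' /K_inj kk'; apply/val_inj/kk'; exact: valP.
transitivity (\sum_(c : {ffun K -> bool})
    (\prod_k coin_prob (tprob a (iota k)) (c k)) *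
     g (Tmap (extend_coins c) (periodic_lift eta))).
  apply: eq_bigr => c _; congr (_ * _); apply: eq_bigr => k _.
  by rewrite vertical_prob_torus_face.
rewrite -(marginal_coins (@tprob R a L)
  (fun c => g (Tmap (extend_coins c) (periodic_lift eta))) iota_inj).
apply: eq_bigr => c _; congr (_ * _).
rewrite -(gE _ _ (fun e _ => val_Tmap_periodic_lift L0 c eta e)).
apply: gK => // f fK.
by rewrite /extend_coins insubT /= ffunE.
Qed.

Lemma torus_face_inj_near (K : {fset face}) :
  exists L1 : nat, forall L, (L1 < L)%N -> {in K &, injective (torus_face L)}.
Proof.
(* The sum dominates every coordinate of every face of [K], as [intr_Zp_inj] requires. *)
exists (\sum_(f <- K) (`|f.1| + `|f.2|))%N => L LL1.
have L0 : (0 < L)%N by apply: leq_ltn_trans LL1.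
have bound f : f \in K -> `|f.1| < L%:Z /\ `|f.2| < L%:Z.
  move=> fK; move: LL1; rewrite (bigD1_seq f) //= => LL1.
  by move: LL1; set s := (\sum_(_ <- _ | _) _)%N; split; lia.
move=> [x y] [x' y'] /bound[/= xL yL] /bound[/= xL' yL'] [xx' yy'].
by rewrite (intr_Zp_inj L0 xL xL' xx') (intr_Zp_inj L0 yL yL' yy').
Qed.

End PlaneCoins.

(** * Expectations of local functions as finite sums *)

(** Only the fibres of [X] are asked to be measurable, since [F] carries no sigma-algebra. *)
Lemma expectation_finite d (W : measurableType d) (R : realType)
    (P : probability W R) (F : finType) (X : W -> F) (h : F -> R) :
  (forall k, measurable (X @^-1` [set k])) ->
  ('E_P[h \o X] = (\sum_k h k * fine (P (X @^-1` [set k])))%:E)%E.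
Proof.
move=> mX; rewrite unlock.
transitivity (\int[P]_w \sum_k ((h k)%:E * (\1_(X @^-1` [set k]) w)%:E))%E.
  apply: eq_integral => w _ /=.
  rewrite (bigD1 (X w)) //= big1 => [|k kX].
    by rewrite indicE mem_set // mule1 adde0.
  rewrite indicE memNset ?mule0 //= => Xk.
  by move: kX; rewrite Xk eqxx.
rewrite integral_sum //; last first.
  by move=> k; apply: integrableZl => //; exact: integrable_indic.
rewrite -sumEFin; apply: eq_bigr => k _.
rewrite integralZl //; last exact: integrable_indic.
rewrite integral_indic // setIT EFinM fineK //.
exact: fin_num_measure.
Qed.

Lemma measurable_dimer (e : edge int) (b : bool) :
  measurable [set eta : Omega | val eta e = b].
Proof.
have m1 : measurable [set eta : Omega | val eta e = true].
  by apply: sub_sigma_algebra; exists e.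
case: b => //; rewrite (_ : mkset _ = ~` [set eta : Omega | val eta e = true]).
  exact: measurableC.
by apply/seteqP; split=> eta /=; case: (sval eta e).
Qed.

Definition window (E : seq (edge int)) (eta : Omega) : {ffun seq_sub E -> bool} :=
  [ffun e => val eta (val e)].

Lemma measurable_window E x : measurable (window E @^-1` [set x]).
Proof.
rewrite (_ : _ @^-1` _ = \bigcap_(e in [set: seq_sub E])
    [set eta : Omega | val eta (val e) = x e]).
  apply: fin_bigcap_measurable => [|e _]; first exact: finite_finset.
  exact: measurable_dimer.
apply/seteqP; split=> eta /=; first by move=> <- e _; rewrite /= ffunE.
by move=> h; apply/ffunP => e; rewrite ffunE; exact: h.
Qed.

Lemma window_factor (R : realType) (E : seq (edge int)) (g : Omega -> R) :
  (forall eta xi : Omega, {in E, val eta =1 val xi} -> g eta = g xi) ->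
  exists h : {ffun seq_sub E -> bool} -> R, g = h \o window E.
Proof.
(* Patterns realised by no matching receive the default value 0. *)
move=> gE; exists (fun x => if pselect (exists eta, window E eta = x) is left ex
  then g (projT1 (cid ex)) else 0).
apply/funext => eta /=; case: pselect => [ex|]; last by case; exists eta.
case: (cid ex) => xi /= /ffunP xiE; apply: gE => e eE.
by have := xiE (SeqSub eE); rewrite !ffunE.
Qed.

Lemma coin_law (R : realType) d (W : measurableType d) (P : probability W R)
    (X : {RV P >-> bool}) (v : R) b :
  P [set w | X w] = v%:E -> P (X @^-1` [set b]) = (coin_prob v b)%:E.
Proof.
move=> Xv; have E : X @^-1` [set true] = [set w | X w].
  by apply/seteqP; split.
case: b => /=; first by rewrite E.
rewrite (_ : _ @^-1` _ = ~` [set w | X w]); last first.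
  by apply/seteqP; split=> w /=; case: (X w).
rewrite probability_setC ?Xv ?EFinB // -E.
exact: measurable_funPTI.
Qed.

Section Mixture.
Context (R : realType) (a : R) (pi : probability Omega R).
Context d (W : measurableType d) (P : probability W R).
Context (eta : {RV P >-> Omega}) (coin : face -> {RV P >-> bool}).
Context (hcoin : config_and_coins a pi eta coin).

Lemma config_and_coins_law (K : {fset face}) (c : {ffun K -> bool}) (A : set Omega) :
  measurable A ->
  P ([set w | forall k : K, coin (val k) w = c k] `&` eta @^-1` A) =
  ((plane_coins_prob a c)%:E * pi A)%E.
Proof.
move=> mA; have [etaE coinE indep] := hcoin.
(* Independence is applied to the finite index set [J]: [None] stands for the configuration,
   [Some f] for the coin of a face of [K]. *)
pose E (i : option face) : set W :=
  if i is Some f then coin f @^-1` [set extend_coins c f] else eta @^-1` A.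
pose J : {fset option face} := (None |` (Some @` K))%fset.
have JE : [set w | forall k : K, coin (val k) w = c k] `&` eta @^-1` A =
    \bigcap_(i in [set` J]) E i.
  apply/seteqP; split=> w /=.
    move=> [wc wA] [f|] // /fset1UP[] // /imfsetP[k /= kK [->]].
    by rewrite /E /= /extend_coins insubT /= -(wc (Sub k kK)).
  move=> wE; split=> [k|]; last by apply: (wE None); rewrite /= !inE.
  have /(wE (Some (val k))) : Some (val k) \in J.
    by rewrite !inE /=; apply/imfsetP; exists (val k) => //; exact: valP.
  by rewrite /E /= /extend_coins valK.
rewrite JE indep => [|[f|] _] /=; last 2 first.
- by exists [set extend_coins c f]; rewrite ?setTI.
- by exists A; rewrite ?setTI.
rewrite big_fsetU1 /=; last by apply/imfsetP => -[].
rewrite -etaE // muleC; congr (_ * _)%E.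
rewrite big_imfset /= => [|? ? _ _ []//].
rewrite big_seq_fsetE /= -prodEFin; apply: eq_bigr => k _.
rewrite (coin_law _ (coinE _)); congr (coin_prob _ _)%:E.
by rewrite /extend_coins valK.
Qed.

(** Given the coins in [K], the configuration still has law [pi]. The coins in [K] and the dimers on
    [E] together form a variable [X] with finitely many values. *)
Lemma expectation_mixture (K : {fset face}) (E : seq (edge int))
    (G : (face -> bool) -> Omega -> R) :
  (forall c c' eta xi, {in K, c =1 c'} -> {in E, val eta =1 val xi} ->
    G c eta = G c' xi) ->
  ('E_P[fun w => G (fun f => coin f w) (eta w)] =
  (\sum_(c : {ffun K -> bool}) plane_coins_prob a c *
     fine 'E_pi[G (extend_coins c)])%:E)%E.
Proof.
move=> GK.
have /choice[h hE] : forall c : {ffun K -> bool}, exists h,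
    G (extend_coins c) = h \o window E.
  by move=> c; apply: window_factor => xi zeta; exact: GK.
pose X w : {ffun K -> bool} * {ffun seq_sub E -> bool} :=
  ([ffun k => coin (val k) w], window E (eta w)).
have XE c x : X @^-1` [set (c, x)] =
    [set w | forall k : K, coin (val k) w = c k] `&` eta @^-1` (window E @^-1` [set x]).
  apply/seteqP; split=> w /=.
    by case=> <- <-; split => // k; rewrite ffunE.
  by move=> [wc <-]; congr pair; apply/ffunP => k; rewrite ffunE wc.
have mX k : measurable (X @^-1` [set k]).
  case: k => c x; rewrite XE; apply: measurableI; last first.
    by apply: measurable_funPTI; exact: measurable_window.
  rewrite (_ : mkset _ = \bigcap_(k in [set: K]) (coin (val k) @^-1` [set c k])).
    apply: fin_bigcap_measurable => [|k _]; first exact: finite_finset.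
    exact: measurable_funPTI.
  by apply/seteqP; split=> w /= wc k; [move=> _|]; exact: wc.
have -> : (fun w => G (fun f => coin f w) (eta w)) =
    (fun k => h k.1 k.2) \o X.
  apply/funext => w /=; rewrite -[RHS]/((h (X w).1 \o window E) (eta w)).
  rewrite -hE; apply: GK => // f fK.
  by rewrite /extend_coins insubT /= ffunE.
rewrite expectation_finite //; congr (_%:E).
transitivity (\sum_c \sum_x h c x * fine (P (X @^-1` [set (c, x)]))).
  by rewrite pair_bigA; apply: eq_bigr => -[].
apply: eq_bigr => c _; rewrite hE expectation_finite /=; last first.
  exact: measurable_window.
rewrite mulr_sumr; apply: eq_bigr => x _.
rewrite XE config_and_coins_law; last exact: measurable_window.
rewrite fineM //=; first by rewrite mulrCA.
by apply: fin_num_measure; exact: measurable_window.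
Qed.

End Mixture.

Lemma expectation_local (R : realType) (pi : probability Omega R) (g : Omega -> R) :
  local_function g -> ('E_pi[g] = (fine 'E_pi[g])%:E)%E.
Proof.
move=> [E /window_factor[h ->]].
by rewrite expectation_finite //; exact: measurable_window.
Qed.

(** * Passage to the infinite lattice *)

(** Supplies explicit height changes of asymptotic slope [rho], along which [slope_measure] is
    evaluated. *)
Lemma floor_slope (R : realType) (r : R) :
  (fun L : nat => (Num.floor (r * L%:R))%:~R / L%:R : R) @ \oo --> r.
Proof.
have h0 : (fun n : nat => r - n%:R^-1 : R) @ \oo --> r.
  rewrite -[X in _ --> X]subr0; apply: cvgB; first exact: cvg_cst.
  by rewrite -cvg_shiftS; exact: cvg_harmonic.
apply: (squeeze_cvgr _ h0 (cvg_cst r)); near=> L.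
have L0 : (0 : R) < L%:R by rewrite ltr0n; near: L; exact: nbhs_infty_gt.
have /andP[lo hi] := floor_itv (r * L%:R).
rewrite ler_pdivrMr // lo andbT ler_pdivlMr // mulrBl mulVf ?gt_eqF //.
by rewrite lerBlDr; apply/ltW; rewrite -intrD1 in hi *.
Unshelve. all: end_near. Qed.

Theorem theorem3p4 (R : realType) (a : R) (ha : 0 < a <= 1)
    (rho : R * R) (hrho : interior (slope_square R) rho)
    (pi : probability Omega R) (hpi : slope_measure a rho pi)
    (d : measure_display) (W : measurableType d) (P : probability W R)
    (eta : {RV P >-> Omega}) (coin : face -> {RV P >-> bool})
    (hcoin : config_and_coins a pi eta coin)
    (g : Omega -> R) (hg : local_function g) :
  ('E_P[fun w => g (Tmap (fun f => coin f w) (eta w))] = 'E_pi[g])%E.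
Proof.
have [E gE] := hg; have [K0 [E' gK0]] := Tmap_local gE.
pose K : {fset face} := [fset f in K0]%fset.
have gK c c' xi zeta : {in K, c =1 c'} -> {in E', val xi =1 val zeta} ->
    g (Tmap c xi) = g (Tmap c' zeta).
  by move=> cc' ?; apply: gK0 => // f fK; apply: cc'; rewrite !inE.
rewrite (expectation_mixture hcoin gK) (expectation_local pi hg); congr (_%:E).
pose Delta (L : nat) : int * int :=
  (Num.floor (rho.1 * L%:R), Num.floor (rho.2 * L%:R)).
have DeltaE : (fun L => ((Delta L).1%:~R / L%:R, (Delta L).2%:~R / L%:R) : R * R)
    @ \oo --> rho.
  exact: (cvg_pair (@floor_slope R rho.1) (@floor_slope R rho.2)).
have limit f : local_function f ->
    (fun L => torus_mean a (Delta L) (fun xi : Omega_torus L => f (periodic_lift xi)))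
      @ \oo --> (fine 'E_pi[f] : R).
  move=> hf; have := hpi _ DeltaE _ hf; rewrite (expectation_local pi hf).
  by move=> /fine_cvgP[_].
have a0 : 0 < a by case/andP: ha.
(* For fixed coins [c] the function of the configuration is local, so the finite mixture converges
   term by term. *)
have lhs : (fun L => \sum_(c : {ffun K -> bool}) plane_coins_prob a c *
      torus_mean a (Delta L)
        (fun xi : Omega_torus L => g (Tmap (extend_coins c) (periodic_lift xi))))
    @ \oo --> \sum_(c : {ffun K -> bool}) plane_coins_prob a c *
      fine 'E_pi[fun xi => g (Tmap (extend_coins c) xi)].
  apply: cvg_big => [|c _]; first exact: add_continuous.
  apply: cvgMr; apply: (limit (fun xi => g (Tmap (extend_coins c) xi))).
  by exists E' => xi zeta; exact: gK.
have [L1 L1P] := torus_face_inj_near K.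
(* For large L the mixture equals the torus mean of [g], so both expectations are limits of the same
   sequence. *)
apply: (cvg_unique _ lhs); first exact: norm_hausdorff.
apply: cvg_trans (limit _ hg); apply: near_eq_cvg; near=> L.
have LL1 : (L1 < L)%N by near: L; exact: nbhs_infty_gt.
by rewrite (torus_mean_Tmap a0 _ _ gE gK (L1P _ LL1)) //; exact: leq_ltn_trans LL1.
Unshelve. all: end_near. Qed.
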